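(* Let $C$ be a finitely generated subgroup of infinite index in a free group $F=F(X)$ of finite rank, and let $S$ be a Schreier transversal for $C$. Then: 1) the set of singular representatives $S_{\rm sin}$ is exponentially negligible relative to $S$; 2) the set $S_{\rm uns}$ of unstable representatives is exponentially negligible relative to $S$.
   Context: $F=F(X)$ is the free group with finite basis $X=\{x_1,\dots,x_m\}$; elements of $F$ are identified with reduced words in $X\cup X^{-1}$, and $|w|$ is the length of the reduced word $w$. Let $S_k=\{w\in F: |w|=k\}$ (the sphere of radius $k$, not to be confused with the transversal $S$). For $R,L\subseteq F$ put $f_k(R,L)=\dfrac{|R\cap S_k|}{|L\cap S_k|}$. The set $R$ is exponentially negligible relative to $L$ (or exponentially negligible in $L$) if there is $q$ with $0<q<1$ such that $f_k(R,L)\le q^k$ for all sufficiently large $k$. A (right) transversal of $C$ is a set $S\subseteq F$ containing exactly one element from each right coset $Cu$, $u\in F$. It is Schreier if every initial segment of an element of $S$ belongs to $S$. The generalized normalizer of $C$ is $N^*_F(C)=\{f\in F : f^{-1}Cf\cap C\neq 1\}$. A representative $s\in S$ is singular if $s\in N^*_F(C)$; $S_{\rm sin}$ is the set of singular representatives in $S$. A representative $s\in S$ is stable if $sc\in S$ for every $c\in C$; $S_{\rm uns}$ is the set of elements of $S$ that are not stable. *)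

(* Defs.v *)
From HB Require Import structures.
From mathcomp Require Import all_boot all_order all_algebra.
From mathcomp Require Import finmap boolp classical_sets functions cardinality.
From mathcomp Require Import reals.

Set Implicit Arguments.
Unset Strict Implicit.
Unset Printing Implicit Defensive.

Local Open Scope classical_set_scope.
Local Open Scope group_scope.

Section FreeGroup.
Variable X : choiceType.

(* The letter (x, true) is the generator x, and (x, false) is its inverse. *)
Local Notation letter := (X * bool)%type.

Definition letter_inv (a : letter) : letter := (a.1, ~~ a.2).

Definition reduced (w : seq letter) : bool :=
  sorted (fun a b => b != letter_inv a) w.

Definition push (a : letter) (w : seq letter) : seq letter :=
  if w is b :: w' then if b == letter_inv a then w' else a :: w else [:: a].

Definition reduce (w : seq letter) : seq letter := foldr push [::] w.

Definition word_inv (w : seq letter) : seq letter := rev (map letter_inv w).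

Lemma letter_invK : involutive letter_inv.
Proof. by case=> x b; rewrite /letter_inv /= negbK. Qed.

Lemma push_reduced a w : reduced w -> reduced (push a w).
Proof.
case: w => [|b w] //= red_w; case: eqP => [_|/eqP nab] /=.
  exact: path_sorted red_w.
by rewrite nab.
Qed.

Lemma pushK a w : reduced w -> push (letter_inv a) (push a w) = w.
Proof.
case: w => [|b w] /=; first by rewrite letter_invK eqxx.
case: (b =P letter_inv a) => [-> |_] /=; last by rewrite letter_invK eqxx.
case: w => [|c w] //= /andP[nc _].
by rewrite letter_invK in nc *; rewrite (negPf nc).
Qed.

Lemma foldr_push_reduced u w : reduced w -> reduced (foldr push w u).
Proof. by move=> red_w; elim: u => //= a u IH; apply: push_reduced. Qed.

Lemma reduce_reduced w : reduced (reduce w).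
Proof. exact: foldr_push_reduced. Qed.

Lemma reduce_id w : reduced w -> reduce w = w.
Proof.
elim: w => //= a w IH red_w; rewrite /reduce /= -/(reduce w).
rewrite IH; last exact: path_sorted red_w.
by case: w red_w {IH} => [|b w] //= /andP[/negPf-> _].
Qed.

Lemma foldr_push_push a u w : reduced w ->
  foldr push w (push a u) = push a (foldr push w u).
Proof.
move=> red_w; case: u => //= b u; case: eqP => //= ->.
by rewrite -{1}[a]letter_invK pushK // foldr_push_reduced.
Qed.

Lemma foldr_push_reduce u w : reduced w ->
  foldr push w (reduce u) = foldr push w u.
Proof.
by move=> red_w; elim: u => //= a u IH; rewrite foldr_push_push // IH.
Qed.

Lemma reduce_catl u v : reduce (reduce u ++ v) = reduce (u ++ v).
Proof. by rewrite /reduce !foldr_cat foldr_push_reduce ?reduce_reduced. Qed.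

Lemma reduce_catr u v : reduce (u ++ reduce v) = reduce (u ++ v).
Proof.
rewrite /reduce !foldr_cat -!/(reduce _).
by rewrite (reduce_id (reduce_reduced v)).
Qed.

Lemma word_inv_reduced w : reduced w -> reduced (word_inv w).
Proof.
rewrite /reduced /word_inv rev_sorted sorted_map; apply: sub_sorted => a b /=.
by apply: contra => /eqP ->; rewrite letter_invK.
Qed.

Lemma reduce_word_inv w : reduce (word_inv w ++ w) = [::].
Proof.
elim: w => //= a w IH; rewrite /word_inv /= rev_cons cat_rcons.
rewrite -[RHS]IH /reduce !foldr_cat /= pushK //; exact: reduce_reduced.
Qed.

Record free_group : Type :=
  FreeGroup { word :> seq letter; word_reduced : reduced word }.

HB.instance Definition _ := [isSub for word].
HB.instance Definition _ := [Choice of free_group by <:].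

Definition free_one : free_group := @FreeGroup [::] isT.
Definition free_mul (u v : free_group) : free_group :=
  FreeGroup (reduce_reduced (u ++ v)).
Definition free_inv (u : free_group) : free_group :=
  FreeGroup (word_inv_reduced (word_reduced u)).

Lemma free_mulA : associative free_mul.
Proof.
by move=> u v w; apply: val_inj; rewrite /= reduce_catr reduce_catl catA.
Qed.

Lemma free_mul1 : left_id free_one free_mul.
Proof. by move=> u; apply/val_inj/reduce_id/word_reduced. Qed.

Lemma free_mulr1 : right_id free_one free_mul.
Proof.
by move=> u; apply: val_inj; rewrite /= cats0; apply/reduce_id/word_reduced.
Qed.

Lemma free_mulV : left_inverse free_one free_inv free_mul.
Proof. by move=> u; apply/val_inj/reduce_word_inv. Qed.

Lemma free_mulrV : right_inverse free_one free_inv free_mul.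
Proof.
move=> u; apply: val_inj; rewrite /= -[X in X ++ _](_ : word_inv (word_inv u) = u).
  exact: reduce_word_inv.
by rewrite /word_inv map_rev revK -map_comp map_id_in // => a _ /=;
  rewrite letter_invK.
Qed.

HB.instance Definition _ :=
  isGroup.Build free_group free_mulA free_mul1 free_mulr1 free_mulV free_mulrV.

End FreeGroup.

Section Subgroups.
Variable G : groupType.
Implicit Types C S A : set G.

Definition subgroup C : Prop := group_closed [in C].

Definition generated A : set G := smallest subgroup A.

Definition finitely_generated C : Prop :=
  exists2 A, finite_set A & C = generated A.

Definition right_coset C (u : G) : set G := [set c * u | c in C].

Definition infinite_index C : Prop := infinite_set (range (right_coset C)).

Definition right_transversal C S : Prop :=
  forall u, exists! s, (S `&` right_coset C u) s.

Definition generalized_normalizer C : set G :=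
  [set f | [set c ^ f | c in C] `&` C <> [set 1]].

Definition singular_part C S : set G := S `&` generalized_normalizer C.

Definition stable C S (s : G) : Prop := forall c, C c -> S (s * c).

Definition unstable_part C S : set G := S `\` [set s | stable C S s].

End Subgroups.

Section FreeGroupSets.
Variable X : finType.
Local Notation F := (free_group X).
Implicit Types C S A B : set F.

Definition schreier_transversal C S : Prop :=
  right_transversal C S /\
  forall s t : F, S s -> prefix (word t) (word s) -> S t.

Definition sphere k : set F := [set w : F | size w = k].

Lemma finite_sphere k : finite_set (sphere k).
Proof.
pose lists : set (seq (X * bool)) := [set val t | t in [set: k.-tuple (X * bool)%type]].
have fl : finite_set lists by apply: finite_image; apply: finite_finset.
have -> : sphere k = (@word X) @^-1` (lists `&` [set w | size w = k]).
  apply/seteqP; split=> w /=; last by case.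
  move=> sw; split=> //; exists (Tuple (introT eqP sw)) => //.
apply: finite_preimage; last exact: finite_setIl.
by move=> u v _ _; apply: val_inj.
Qed.

(* The intersections are finite by finite_sphere, so that fset_set is not the
   default value fset0.  The quotient is 0 when B does not meet the sphere. *)
Definition relative_frequency (R : realType) A B k : R :=
  (#|` fset_set (A `&` sphere k)|%:R / #|` fset_set (B `&` sphere k)|%:R)%R.

Definition exponentially_negligible (R : realType) A B : Prop :=
  exists2 q : R, (0 < q < 1)%R &
    exists k0, forall k, (k0 <= k)%N ->
      (relative_frequency R A B k <= q ^+ k)%R.

End FreeGroupSets.

(* Main.v *)
Require Import Defs.
From mathcomp Require Import all_boot all_order all_algebra.
From mathcomp Require Import finmap boolp classical_sets functions cardinality.
From mathcomp Require Import reals.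

Set Implicit Arguments.
Unset Strict Implicit.
Unset Printing Implicit Defensive.

Local Open Scope classical_set_scope.
Local Open Scope group_scope.

(** Read a reduced word as a path from the vertex [C] in the coset graph of [C]
in [F]. The cosets [C p], for [p] a prefix of an element of [C], are the vertices
of a subgraph, the core; the rest of the coset graph consists of trees hanging
from the core, and a reduced path that leaves the core never returns
([core_prefix]). When [C] is finitely generated the core is finite
([core_finite]), and when [C] moreover has infinite index the core is not the
whole graph ([core_infinite_index]).

A Schreier transversal [S] is a spanning tree. Once the tree path of an element
[s] of [S] has left the core, all its reduced continuations are in [S] again
([schreier_extend]). Write [s = u a v], where [a] is the first letter that leaves
the core. If multiplying [s] on the right by [c] in [C] leads out of [S], then the
cancellation in [s c] has to eat up all of [v], so that the inverse of [v] is a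
prefix of [c], hence a path inside the core ([unstable_tail]). As [u] has bounded
length, the inverse of an unstable [s] of length [k] is a path inside the core
except for its last boundedly many letters ([unstable_inv_core]).
A singular representative is unstable: if [s d = c s] with [c] and [d] in [C], then
[s d] and [s] are in the same coset, so [s d] cannot be in [S] unless [d = 1]
([singular_sub_unstable]). Only the unstable part has to be estimated.

It remains to count. Let [n] be the number of letters, generators and inverses
together, so that a nonempty reduced word has [n - 1] reduced extensions by one
letter. For [k] large, [S] contains at least [(n - 1) ^ (k - s)] elements of
length [k], for a constant [s]: the extensions of one path leaving the core
([schreier_growth]). On the other hand there is a constant [L > 0] such that every
nonempty path in the core can be extended to a reduced path of [L] more letters
that leaves the core ([core_uniform_escape]); hence lengthening the paths in the
core by [L] multiplies their number by at most [(n - 1) ^ L - 1]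
([core_growth]). The quotient of the resulting bounds therefore shrinks by a fixed factor
less than [1] whenever [k] grows by [L], which makes it exponentially small
([geometric_decay]). *)

(** * Reduced words and cancellation *)

Section Words.
Variable X : choiceType.
Local Notation letter := (X * bool)%type.
Local Notation F := (free_group X).
Implicit Types (u v w z : seq letter) (a b : letter) (x y : F).

Definition eval w : F := FreeGroup (reduce_reduced w).

Lemma word_eval w : reduced w -> word (eval w) = w.
Proof. exact: reduce_id. Qed.

Lemma evalK : cancel (@word X) eval.
Proof. by move=> x; apply/val_inj/word_eval/word_reduced. Qed.

Lemma eval_cat u v : eval (u ++ v) = eval u * eval v.
Proof. by apply: val_inj; rewrite /= reduce_catr reduce_catl. Qed.

Lemma eval_nil : eval [::] = 1.
Proof. exact: val_inj. Qed.

Lemma word_invK : involutive (@word_inv X).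
Proof.
by move=> w; rewrite /word_inv map_rev revK mapK //; apply: letter_invK.
Qed.

Lemma word_inv_cat u v : word_inv (u ++ v) = word_inv v ++ word_inv u.
Proof. by rewrite /word_inv map_cat rev_cat. Qed.

Lemma size_word_inv w : size (word_inv w) = size w.
Proof. by rewrite /word_inv size_rev size_map. Qed.

Lemma eval_inv w : eval (word_inv w) = (eval w)^-1.
Proof.
have: eval (word_inv w) * eval w = 1.
  by rewrite -eval_cat; apply/val_inj/reduce_word_inv.
by move=> /(canRL (mulgK _)); rewrite mul1g.
Qed.

Lemma reduced_catl u v : reduced (u ++ v) -> reduced u.
Proof. by rewrite /reduced; case: u => //= a u; rewrite cat_path => /andP[]. Qed.

Lemma reduced_catr u v : reduced (u ++ v) -> reduced v.
Proof.
by elim: u => //= a u IH /path_sorted; exact: IH.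
Qed.

Lemma reduced_cat_cons u a v :
  reduced (u ++ a :: v) = reduced (rcons u a) && reduced (a :: v).
Proof.
by rewrite /reduced; case: u => //= b u; rewrite rcons_path cat_path /= andbA.
Qed.

Lemma letter_inv_neq a : a != letter_inv a.
Proof. by case: a => x b; rewrite /letter_inv xpair_eqE /= eqxx; case: b. Qed.

Lemma reduced_pad a w i : reduced (a :: w) -> reduced (a :: w ++ nseq i (last a w)).
Proof.
rewrite /reduced /= cat_path => ->; move: (last a w) => b /=.
by elim: i => //= i ->; rewrite letter_inv_neq.
Qed.

Lemma prefix_catP w u v : prefix w (u ++ v) ->
  prefix w u \/ exists2 t, w = u ++ t & prefix t v.
Proof.
elim: u w => [|a u IH] [|b w]; rewrite ?prefix0s; try by left.
  by right; exists (b :: w).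
rewrite cat_cons !prefix_cons => /andP[/eqP-> /IH[->|[t -> ptv]]].
  by left; rewrite eqxx.
by right; exists t.
Qed.

Lemma cancellation u v : reduced u -> reduced v ->
  exists s z t, [/\ u = s ++ z, v = word_inv z ++ t & reduced (s ++ t)].
Proof.
elim/last_ind: u v => [|u a IH] v red_u red_v; first by exists [::], [::], v.
case: v red_v => [|b v] red_v.
  by exists (rcons u a), [::], [::]; rewrite !cats0.
have [eq_b|neq_b] := eqVneq b (letter_inv a); last first.
  exists (rcons u a), [::], (b :: v); rewrite cats0; split=> //.
  by rewrite cat_rcons reduced_cat_cons red_u /reduced /= neq_b.
have [s [z [t [-> -> red_st]]]] : exists s z t,
    [/\ u = s ++ z, v = word_inv z ++ t & reduced (s ++ t)].
  apply: IH; last exact: path_sorted red_v.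
  by apply: (@reduced_catl u [:: a]); rewrite cats1.
exists s, (rcons z a), t; split=> //; first by rewrite rcons_cat.
by rewrite -cats1 word_inv_cat eq_b.
Qed.

Lemma word_mulP x y : exists u z v,
  [/\ word x = u ++ z, word y = word_inv z ++ v & word (x * y) = u ++ v].
Proof.
have [u [z [v [ex ey red]]]] := cancellation (word_reduced x) (word_reduced y).
exists u, z, v; split=> //; rewrite -(word_eval red); congr word.
rewrite -[x]evalK -[y]evalK ex ey !eval_cat eval_inv -mulgA.
by rewrite (mulgA (eval z)) mulgV mul1g.
Qed.

(** The word [z] is the longest common suffix of the two words. If [x] and [y] are in
the same right coset of [C], then [u] and the inverse of [v] are the two halves of
an element of [C]: this is how cosets are related to words below. *)
Lemma word_divP x y : exists u v z,
  [/\ word x = u ++ z, word y = v ++ z & word (x * y^-1) = u ++ word_inv v].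
Proof.
have [u [z [v [ex ey exy]]]] := word_mulP x y^-1.
exists u, (word_inv v), z; split=> //; last by rewrite word_invK.
rewrite -[LHS]word_invK -[word_inv (word y)]/(word y^-1) ey.
by rewrite word_inv_cat word_invK.
Qed.

End Words.

(** * The core of the coset graph *)

Section Subgroup.
Variables (G : groupType) (C : set G).
Hypothesis gC : subgroup C.
Implicit Types x y : G.

Lemma subgroup1 : C 1.
Proof. by have [/set_mem]:= gC. Qed.

Lemma subgroupV x : C x -> C x^-1.
Proof.
by move=> Cx; apply/set_mem/(group_closedV gC)/mem_set.
Qed.

Lemma subgroupM x y : C x -> C y -> C (x * y).
Proof.
by move=> Cx Cy; apply/set_mem/(group_closedM gC); apply/mem_set.
Qed.

End Subgroup.

Section Core.
Variables (X : choiceType) (C : set (free_group X)).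
Hypothesis gC : subgroup C.
Local Notation letter := (X * bool)%type.
Local Notation F := (free_group X).
Implicit Types (u v w z : seq letter) (a b : letter) (x y : F).

(** The elements whose right coset is a vertex of the core, that is, contains a
prefix of an element of [C]. By [core_prefix], the word of such an element is the
label of a path inside the core. *)
Definition core : set F := [set x | exists2 c, C c &
  exists2 d, C d & prefix (word (c * x)) (word d)].

Lemma core_prefix_of d x : C d -> prefix (word x) (word d) -> core x.
Proof.
by move=> Cd px; exists 1; [exact: (subgroup1 gC)|exists d; rewrite ?mul1g].
Qed.

Lemma core1 : core 1.
Proof. exact: (core_prefix_of (subgroup1 gC)). Qed.

Lemma core_mull c x : C c -> core x -> core (c * x).
Proof.
move=> Cc [c' Cc' [d Cd pd]]; exists (c' * c^-1).
  by apply: (subgroupM gC) => //; apply: (subgroupV gC).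
by exists d; rewrite // -!mulgA mulKg.
Qed.

Lemma core_coset x y : C (x * y^-1) -> core x -> core y.
Proof.
move=> /(subgroupV gC) Cxy /(core_mull Cxy).
by rewrite invgM invgK -mulgA mulVg mulg1.
Qed.

(** Let [p = c x] be a prefix of an element of [C], and strip from [x] and [p] their
longest common suffix [z]: the rest [u] of [x] is a prefix of the element
[x p^-1] of [C]. A prefix of [x] is either a prefix of [u], or [u] followed by a
prefix of [z]; the latter has the same coset as a prefix of [p]. *)
Lemma core_prefix x y : core x -> prefix (word y) (word x) -> core y.
Proof.
move=> [c Cc [d Cd /prefixP[t ed]]] pyx.
have [u [v [z [exu exv exy]]]] := word_divP x (c * x).
have Cxx : C (x * (c * x)^-1).
  by rewrite invgM mulgA mulgV mul1g; apply: (subgroupV gC).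
have : prefix (word y) (u ++ z) by rewrite -exu.
case/prefix_catP => [pyu|[z1 ey /prefixP[t' ez]]].
  by apply: (core_prefix_of Cxx); rewrite exy prefix_catl.
have red_vz1 : reduced (v ++ z1).
  by have := word_reduced (c * x); rewrite exv ez catA => /reduced_catl.
apply: (@core_coset (eval (v ++ z1))); last first.
  apply: (core_prefix_of Cd); rewrite word_eval // ed exv ez.
  by rewrite catA prefix_catl ?prefix_prefix.
rewrite -[y]evalK ey !eval_cat invgM mulgA mulgK -eval_inv -eval_cat.
have := subgroupV gC Cxx.
by rewrite -{1}[x * _]evalK exy -eval_inv word_inv_cat word_invK.
Qed.

(** The prefixes of the generators represent all the vertices of the core: the
elements of [C] all of whose prefixes lie in the coset of a prefix of a generator
form a subgroup. *)
Lemma core_finite : finitely_generated C ->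
  exists T : seq F, forall x, core x -> exists2 t, t \in T & C (x * t^-1).
Proof.
move=> [A /finite_seqP[sA eA] eC].
pose T := 1 :: flatten
  [seq [seq eval (take i (word a)) | i <- iota 0 (size (word a)).+1] | a : F <- sA].
pose good x := exists2 t, t \in T & C (x * t^-1).
have goodM c x : C c -> good x -> good (c * x).
  by move=> Cc [t Tt Cxt]; exists t => //; rewrite -mulgA; apply: (subgroupM gC).
pose D := [set d | C d /\ forall x, prefix (word x) (word d) -> good x].
have gD : subgroup D.
  suff DP : D 1 /\ forall x y, D x -> D y -> D (x * y^-1).
    by case: DP => D1 DF; split=> [|x y /set_mem Dx /set_mem Dy]; apply/mem_set; auto.
  split.
    split; first exact: (subgroup1 gC).
    move=> x; rewrite prefixs0 => /eqP x0; exists 1; first exact: mem_head.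
    by rewrite -[x]evalK x0 eval_nil mulgV; apply: (subgroup1 gC).
  move=> x y [Cx Dx] [Cy Dy]; have Cy' := subgroupV gC Cy.
  split; first exact: subgroupM.
  (* A prefix of y^-1 is y^-1 times a prefix of y. *)
  have Dy' (w : F) : prefix (word w) (word y^-1) -> good w.
    move=> /prefixP[s ey]; rewrite -[w](mulVKg y^-1) invgK.
    apply: goodM => //; apply: Dy; rewrite -[y * w]evalK.
    have -> : y * w = eval (word_inv s).
      by rewrite -[y]invgK -[y^-1]evalK ey eval_cat evalK eval_inv invgM mulgVK.
    have ey2 : word y = word_inv s ++ word_inv (word w).
      by rewrite -word_inv_cat -ey /= word_invK.
    rewrite evalK word_eval ?ey2 ?prefix_prefix //.
    by have := word_reduced y; rewrite ey2 => /reduced_catl.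
  (* A prefix of x y^-1 is a prefix of x, or x times a prefix of y^-1: the letters
     of z cancel. *)
  have [u [z [v [ex ey exy]]]] := word_mulP x y^-1.
  move=> w; rewrite exy; case/prefix_catP => [pwu|[v1 ew1 /prefixP[s ev]]].
    by apply: Dx; rewrite ex prefix_catl.
  rewrite -[w]evalK ew1 eval_cat -[eval u](mulgK (eval z)) -(eval_cat u) -ex evalK.
  rewrite -mulgA -eval_inv -eval_cat.
  apply: goodM => //; apply: Dy'; rewrite ey ev catA word_eval ?prefix_prefix //.
  by have := word_reduced y^-1; rewrite ey ev catA => /reduced_catl.
have CD : C `<=` D.
  rewrite {1}eC; apply: smallest_sub => // a Aa; split.
    by rewrite eC; apply: sub_gen_smallest.
  move=> x px; exists x; last by rewrite mulgV; apply: (subgroup1 gC).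
  rewrite inE; apply/orP; right; apply/flatten_mapP.
  exists a; first by rewrite eA in Aa.
  apply/mapP; exists (size (word x)); first by rewrite mem_iota /= ltnS size_prefix.
  by move: px; rewrite prefixE => /eqP->; rewrite evalK.
exists T => x [c Cc [d /CD[_ Dd] /Dd]] /(goodM c^-1 _ (subgroupV gC Cc)).
by rewrite mulKg.
Qed.

Lemma core_infinite_index : finitely_generated C -> infinite_index C ->
  exists x, ~ core x.
Proof.
move=> /core_finite[T TP] infC; apply: contrapT => /forallNP allE; apply: infC.
apply: (@sub_finite_set _ _ (right_coset C @` [set` T])); last exact: finite_image.
move=> _ [x _ <-]; have /contrapT/TP[t Tt Cxt] := allE x; exists t => //.
apply/seteqP; split=> _ [c Cc <-].
  exists (c * (t * x^-1)); last by rewrite !mulgA mulgVK.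
  by apply: (subgroupM gC) => //; have := subgroupV gC Cxt; rewrite invgM invgK.
by exists (c * (x * t^-1)); [apply: (subgroupM gC)|rewrite !mulgA mulgVK].
Qed.

Lemma escape_point w : ~ core (eval w) -> exists u a v,
  [/\ w = u ++ a :: v, core (eval u) & ~ core (eval (rcons u a))].
Proof.
elim/last_ind: w => [|w b IH] nKw; first by case: nKw; rewrite eval_nil; exact: core1.
have [Kw|/IH[u [a [v [-> Ku nKua]]]]] := pselect (core (eval w)).
  by exists w, b, [::]; rewrite cats1.
by exists u, a, (rcons v b); rewrite rcons_cat.
Qed.

End Core.

(** * Leaving the core *)

Section Escape.
Variables (X : choiceType) (C : set (free_group X)).
Hypotheses (gC : subgroup C) (fgC : finitely_generated C).
Hypothesis infC : infinite_index C.
Local Notation letter := (X * bool)%type.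
Local Notation F := (free_group X).
Local Notation core := (core C).
Implicit Types (u v w z : seq letter) (a b : letter) (x y : F).

(** Two of the cosets [C x y^i] coincide since the core has finitely many vertices,
and right multiplication by [y] is injective on cosets, so that the orbit is
periodic from the start. *)
Lemma core_power_return x y : (forall i, core (x * y ^+ i)) ->
  exists i, C (x * y ^+ i.+1 * x^-1).
Proof.
move=> Kxy; have [T TP] := core_finite gC fgC.
have /choice[f fP] i : exists t, t \in T /\ C (x * y ^+ i * t^-1).
  by have [t Tt Ct] := TP _ (Kxy i); exists t.
have /(uniqPn 1)[i [j [lt_ij]]] : ~~ uniq [seq f i | i <- iota 0 (size T).+1].
  apply/negP => /uniq_leq_size le_fT; have: (size T < size T)%N.
    rewrite -[X in (X < _)%N](size_iota 0) -(size_map f) -ltnS /= size_map size_iota.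
    have := le_fT T; rewrite size_map size_iota; apply.
    by move=> _ /mapP[i _ ->]; case: (fP i).
  by rewrite ltnn.
rewrite size_map size_iota => lt_j; have lt_i := ltn_trans lt_ij lt_j.
rewrite !(nth_map 0%N) ?size_iota // !nth_iota // !add0n => eqf.
exists (j - i.+1)%N; rewrite subnSK //.
have [[_ Ci] [_ Cj]] := (fP i, fP j).
have := subgroupM gC Cj (subgroupV gC Ci).
by rewrite eqf invgM invgK mulgA mulgVK expgnFr 1?ltnW // invgM !mulgA.
Qed.

(** Suppose that no reduced path starting at [C x] without an initial [a^-1] leaves
the core, and let [W] be the set of all such starting points. It is preserved by
[a], hence by [a^-1] as the core is finite. A reduced path from [W] that starts
with letters [a^-1] can then be shortened by these letters, so no reduced path
from [C x] whatsoever leaves the core: the core is the whole coset graph. *)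
Lemma core_escape x a : exists2 u, reduced (a :: u) & ~ core (x * eval u).
Proof.
apply: contrapT => /forall2NP noescape.
pose W y := forall u, reduced (a :: u) -> core (y * eval u).
have Wx : W x by move=> u red_u; case: (noescape u) => [/(_ red_u)|/contrapT].
have Wcoset y (z : F) : C (y * z^-1) -> W y -> W z.
  move=> Cyz Wy u /Wy; apply: core_coset => //.
  by rewrite invgM mulgA mulgK.
have Wa y : W y -> W (y * eval [:: a]).
  move=> Wy u red_u; rewrite -mulgA -eval_cat; apply: Wy.
  by rewrite /= letter_inv_neq.
have WX y i : W y -> W (y * eval [:: a] ^+ i).
  elim: i => [|i IH] Wy; first by rewrite mulg1.
  by rewrite expgSr mulgA; apply/Wa/IH.
have WV y : W y -> W (y * (eval [:: a])^-1).
  move=> Wy.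
  have [i Ci] : exists i, C (y * eval [:: a] ^+ i.+1 * y^-1).
    apply: core_power_return => i.
    by have := WX _ i Wy [::] isT; rewrite eval_nil mulg1.
  apply: Wcoset (WX _ i Wy); rewrite invgM invgK.
  by move: Ci; rewrite expgSr !mulgA.
have Wall u : reduced u -> forall y, W y -> core (y * eval u).
  elim: u => [|b u IH] red_bu y Wy; first exact: Wy.
  have [eq_b|neq_b] := eqVneq b (letter_inv a); last first.
    by apply: Wy; rewrite /reduced /= neq_b.
  rewrite (eval_cat [:: b]) mulgA eq_b (eval_inv [:: a]).
  by apply: IH; [apply: path_sorted red_bu|apply: WV].
have [z] := core_infinite_index gC fgC infC; apply.
by have := Wall _ (word_reduced (x^-1 * z)) x Wx; rewrite evalK mulVKg.
Qed.

End Escape.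

Lemma uniform_bound (I : eqType) (T : seq I) (P : I -> nat -> Prop) :
  (forall t l l', (l <= l')%N -> P t l -> P t l') ->
  (forall t, exists l, P t l) -> exists L, forall t, t \in T -> P t L.
Proof.
move=> Pmono Pex; elim: T => [|t T [L LP]]; first by exists 0%N.
have [l Pl] := Pex t; exists (maxn l L) => s; rewrite inE => /orP[/eqP->|/LP].
  exact: Pmono (leq_maxl _ _) Pl.
exact/Pmono/leq_maxr.
Qed.

Section FiniteEscape.
Variables (X : finType) (C : set (free_group X)).
Hypotheses (gC : subgroup C) (fgC : finitely_generated C).
Hypothesis infC : infinite_index C.
Local Notation letter := (X * bool)%type.
Local Notation F := (free_group X).
Local Notation core := (core C).
Implicit Types (u v w z : seq letter) (a b : letter) (x y : F).

(** The way out given by [core_escape] depends only on the coset and the last letter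
of the path, which leaves finitely many cases; the shorter ways out are padded
by repeating their last letter. *)
Lemma core_uniform_escape : exists L, forall w, reduced w -> w != [::] ->
  core (eval w) ->
  exists u, [/\ size u = L.+1, reduced (w ++ u) & ~ core (eval (w ++ u))].
Proof.
have [T TP] := core_finite gC fgC.
pose P (ta : F * letter) l :=
  exists u, [/\ (size u <= l)%N, reduced (ta.2 :: u) & ~ core (ta.1 * eval u)].
have [L LP] : exists L, forall ta,
    ta \in [seq (t, a) | t <- T, a <- enum {: letter}] -> P ta L.
  apply: uniform_bound => [ta l l' le_l [u [le_u ? ?]]|[t a]].
    by exists u; split => //; apply: leq_trans le_l.
  have [u red_u nKu] := core_escape gC fgC infC t a.
  by exists (size u), u.
exists L => w; case/lastP: w => // w a red_w _ /TP[t Tt Ct].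
have [|u [/= le_u red_u nKu]] := LP (t, a).
  by apply/allpairsP; exists (t, a); rewrite mem_enum.
have red_wu : reduced (rcons w a ++ u) by rewrite cat_rcons reduced_cat_cons red_w.
have nKwu : ~ core (eval (rcons w a ++ u)).
  move=> Kwu; apply: nKu; apply: core_coset Kwu => //.
  by rewrite eval_cat invgM mulgA mulgK.
exists (u ++ nseq (L.+1 - size u) (last a u)); split.
- by rewrite size_cat size_nseq subnKC // leqW.
- rewrite cat_rcons reduced_cat_cons red_w; exact: reduced_pad.
move=> Kpad; apply: nKwu; apply: core_prefix Kpad _ => //.
rewrite !word_eval ?catA ?prefix_prefix //.
by rewrite -catA cat_rcons reduced_cat_cons red_w; apply: reduced_pad.
Qed.

End FiniteEscape.

(** * Schreier transversals outside the core *)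

Section Transversal.
Variables (G : groupType) (C S : set G).
Hypotheses (gC : subgroup C) (trS : right_transversal C S).
Implicit Types x y s t : G.

Lemma transversal_ex x : exists2 s, S s & C (s * x^-1).
Proof.
have [s [[Ss [c Cc eqs]] _]] := trS x.
by exists s; rewrite // -eqs mulgK.
Qed.

Lemma transversal_inj s t : S s -> S t -> C (s * t^-1) -> s = t.
Proof.
move=> Ss St Cst; have [r [_ r_uniq]] := trS t.
rewrite -(r_uniq s); last by split=> //; exists (s * t^-1); rewrite ?mulgVK.
by apply: r_uniq; split=> //; exists 1; rewrite ?mul1g //; exact: subgroup1.
Qed.

(** If [c ^ x] is in [C], then [x * c ^ x = c * x] is in the coset of [x], so it
equals [x] if [x] is stable. *)
Lemma singular_sub_unstable : singular_part C S `<=` unstable_part C S.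
Proof.
move=> x [Sx singx]; split=> // stabx; apply: singx.
apply/seteqP; split=> [y [[c Cc <-]] Cy|_ ->]; last first.
  have C1 := subgroup1 gC; split=> //; exists 1 => //; exact: conj1g.
have Sxy := stabx _ Cy; have eqx : x * c ^ x = c * x by rewrite -conjgC.
have xyx : x * c ^ x = x by apply: (transversal_inj Sxy Sx); rewrite eqx mulgK.
by apply: (mulgI x); rewrite mulg1.
Qed.

End Transversal.

Section Schreier.
Variables (X : finType) (C S : set (free_group X)).
Hypotheses (gC : subgroup C) (fgC : finitely_generated C).
Hypotheses (infC : infinite_index C) (schS : schreier_transversal C S).
Local Notation letter := (X * bool)%type.
Local Notation F := (free_group X).
Local Notation core := (core C).
Implicit Types (u v w z : seq letter) (a b : letter) (x y : F).

Let trS : right_transversal C S. Proof. by case: schS. Qed.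

Lemma schreier_prefix u v :
  reduced (u ++ v) -> S (eval (u ++ v)) -> S (eval u).
Proof.
move=> red_uv Suv; have [_ closS] := schS; apply: closS Suv _.
by rewrite !word_eval ?prefix_prefix // (reduced_catl red_uv).
Qed.

(** Let [s] in [S] represent the coset of [w = u a v], and let [z] be the longest
common suffix of [s] and [w], [w = p z]. Since [p] is a path inside the core, it
ends before the letter [a], so that [z = z0 a v] with [u = p z0]. The prefix
[q z0] of [s = q z] is in [S] and in the coset of [u], whence [q z0 = u] and
[s = w]. *)
Lemma schreier_extend u a v : S (eval u) -> ~ core (eval (rcons u a)) ->
  reduced (u ++ a :: v) -> S (eval (u ++ a :: v)).
Proof.
set w := u ++ _ => Su nKua red_w; have [s Ss Csw] := transversal_ex trS (eval w).
have [q [p [z [es ew esw]]]] := word_divP s (eval w); rewrite word_eval // in ew.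
have Kp y : prefix (word y) p -> core y.
  move=> pyp; apply: (core_prefix_of gC (subgroupV gC Csw)).
  rewrite -[s * _]evalK esw -eval_inv word_inv_cat word_invK word_eval.
    exact: prefix_catl.
  have := word_inv_reduced (word_reduced (s * (eval w)^-1)).
  by rewrite esw word_inv_cat word_invK.
have ew' : w = rcons u a ++ v by rewrite cat_rcons.
have red_ua : reduced (rcons u a) by rewrite ew' in red_w; exact: reduced_catl red_w.
have pua : ~ prefix (rcons u a) p by move=> pu; apply/nKua/Kp; rewrite word_eval.
have [z0 eu] : exists z0, u = p ++ z0.
  have : prefix p w by rewrite ew prefix_prefix.
  case/prefix_catP => [/prefixP[z0 ->]|[[|b v1] ep]]; first by exists z0.
    by exists [::]; rewrite ep !cats0.
  rewrite prefix_cons => /andP[/eqP eb _]; case: pua.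
  by rewrite ep eb -cat_rcons prefix_prefix.
have ez : z = z0 ++ a :: v.
  have /eqP : p ++ z == p ++ (z0 ++ a :: v) by rewrite catA -eu -ew.
  by move/eqP; rewrite eqseq_cat // eqxx => /eqP.
have red_s := word_reduced s; rewrite es ez catA in red_s.
have eq_qu : eval (q ++ z0) = eval u.
  apply: (transversal_inj gC trS) => //.
    by apply: (schreier_prefix red_s); rewrite -catA -ez -es evalK.
  by rewrite eu !eval_cat invgM mulgA mulgK -eval_inv -eval_cat -esw evalK.
suff -> : eval w = s by [].
by rewrite -[s]evalK es ez catA eval_cat eq_qu -eval_cat.
Qed.

(** If the cancellation in [x * c] does not eat up [v], then [u a] is still a prefix
of [x * c], which is in [S] by [schreier_extend]. *)
Lemma unstable_tail u a v c x : S x -> word x = u ++ a :: v ->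
  ~ core (eval (rcons u a)) -> C c -> ~ S (x * c) -> core (eval (word_inv v)).
Proof.
move=> Sx ex nKua Cc nSxc; have [p [z [t [exp ecz exc]]]] := word_mulP x c.
have red_x := word_reduced x; have red_c := word_reduced c.
have Su : S (eval u) by apply: (@schreier_prefix u (a :: v)); rewrite -ex ?evalK.
have : prefix p (rcons u a ++ v) by rewrite cat_rcons -ex exp prefix_prefix.
case/prefix_catP => [/prefixP[z1 eua]|[v1 ep _]].
  have ez : z = z1 ++ v.
    have /eqP : p ++ z == p ++ (z1 ++ v) by rewrite catA -eua cat_rcons -ex -exp.
    by move/eqP; rewrite eqseq_cat // eqxx => /eqP.
  rewrite ecz ez word_inv_cat -catA in red_c.
  apply: (core_prefix_of gC Cc); rewrite word_eval ?(reduced_catl red_c) //.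
  by rewrite ecz ez word_inv_cat -catA prefix_prefix.
have red_xc := word_reduced (x * c).
case: nSxc; rewrite -[x * c]evalK exc ep cat_rcons -catA.
by apply: schreier_extend => //; rewrite -cat_rcons catA -ep -exc.
Qed.

(** Inverting [x] turns the tail [v] of [unstable_tail] into a prefix. The constant
[M] comes from the prefix [u a] of [x], where [u] is one of the finitely many
elements of [S] in the core; the elements [x] of [S] in the core are covered by
the empty prefix. *)
Lemma unstable_inv_core : exists M, forall x, unstable_part C S x ->
  exists y, [/\ core y, prefix (word y) (word x^-1) &
    (size (word x) <= size (word y) + M)%N].
Proof.
have [T TP] := core_finite gC fgC.
have [M MP] : exists M, forall t, t \in T ->
    forall x, S x -> C (x * t^-1) -> (size (word x) <= M)%N.
  apply: uniform_bound => [t l l' le_l lP x Sx Cx|t].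
    exact: leq_trans (lP x Sx Cx) le_l.
  have [s Ss Cs] := transversal_ex trS t; exists (size (word s)) => x Sx Cx.
  rewrite (transversal_inj gC trS Sx Ss) //.
  by have := subgroupM gC Cx (subgroupV gC Cs); rewrite invgM invgK mulgA mulgVK.
exists M.+1 => x [Sx nstab].
have [Kx|nKx] := pselect (core x).
  exists 1; split; [exact: core1|exact: prefix0s|].
  by have [t Tt Ct] := TP _ Kx; rewrite /= add0n ltnW // ltnS (MP t).
have [u [a [v [ex Ku nKua]]]] : exists u a v,
    [/\ word x = u ++ a :: v, core (eval u) & ~ core (eval (rcons u a))].
  by apply: escape_point; rewrite ?evalK.
have [c Cc nSxc] : exists2 c, C c & ~ S (x * c).
  by apply: contrapT => /forall2NP stab; apply: nstab => c Cc;
     case: (stab c) => // /contrapT.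
have Kv := unstable_tail Sx ex nKua Cc nSxc.
have red_x := word_reduced x; rewrite ex in red_x.
have red_v : reduced (word_inv v).
  by apply: word_inv_reduced; move: red_x; rewrite -cat_rcons => /reduced_catr.
exists (eval (word_inv v)); split=> //; rewrite word_eval //.
  by rewrite /= ex -cat_rcons word_inv_cat prefix_prefix.
have [t Tt Ct] := TP _ Ku.
rewrite ex size_cat size_word_inv /= !addnS ltnS addnC leq_add2l.
rewrite -[u](word_eval (reduced_catl red_x)) (MP t) //.
by apply: (schreier_prefix red_x); rewrite -ex evalK.
Qed.

Lemma schreier_escape : exists u a,
  [/\ S (eval u), ~ core (eval (rcons u a)) & reduced (rcons u a)].
Proof.
have [x nKx] := core_infinite_index gC fgC infC.
have [s Ss Cs] := transversal_ex trS x.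
have nKs : ~ core s by move=> /(core_coset gC Cs).
have [u [a [v [es Ku nKua]]]] : exists u a v,
    [/\ word s = u ++ a :: v, core (eval u) & ~ core (eval (rcons u a))].
  by apply: escape_point; rewrite ?evalK.
have red_s := word_reduced s; rewrite es in red_s.
exists u, a; split=> //; last by move: red_s; rewrite reduced_cat_cons => /andP[].
by apply: (schreier_prefix red_s); rewrite -es evalK.
Qed.

End Schreier.

(** * Counting reduced words *)

Section Counting.
Variable X : finType.
Local Notation letter := (X * bool)%type.
Local Notation F := (free_group X).
Implicit Types (p q u v w : seq letter) (a b : letter) (x y : F) (A B : set F).

(** Counting the words with a given prefix [p], and not only those of a sphere, is
what makes induction on the missing letters possible. *)
Definition nwords n A p :=
  #|[pred t : n.-tuple letter | [&& reduced t, prefix p t & `[< A (eval t) >]]]|.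

Lemma nwords_le_sub n A B p q :
  (forall w, size w = n -> reduced w -> prefix p w -> A (eval w) ->
    prefix q w /\ B (eval w)) ->
  (nwords n A p <= nwords n B q)%N.
Proof.
move=> AB; apply/subset_leq_card/fintype.subsetP => t; rewrite !inE.
case/and3P => red_t pt /asboolP At; rewrite red_t /=.
by have [->] := AB t (size_tuple t) red_t pt At => /asboolP ->.
Qed.

Lemma nwords_eq0 n A p :
  (forall w, size w = n -> reduced w -> prefix p w -> ~ A (eval w)) ->
  nwords n A p = 0%N.
Proof.
move=> nA; apply: eq_card0 => t; rewrite inE; apply/and3P => -[red_t pt /asboolP].
exact: nA (size_tuple t) red_t pt.
Qed.

Lemma nwords_size n A p : size p = n ->
  nwords n A p = reduced p && `[< A (eval p) >].
Proof.
move=> <-; have [/andP[red_p Ap]|nAp] := boolP (reduced p && _); last first.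
  apply: eq_card0 => t; rewrite inE; apply/and3P => -[red_t].
  rewrite prefixE take_oversize ?size_tuple // => /eqP t_p At; case/negP: nAp.
  by rewrite -t_p red_t.
rewrite /nwords (fintype.eq_card1 (x := in_tuple p)) // => t.
rewrite !inE prefixE take_oversize ?size_tuple // -val_eqE /=.
by case: eqP => [->|]; rewrite ?andbF // red_p Ap.
Qed.

Lemma nwords_rcons n A p : (size p < n)%N ->
  nwords n A p = (\sum_(b : letter) nwords n A (rcons p b))%N.
Proof.
move=> lt_pn; rewrite /nwords -sum1_card.
rewrite (partition_big (fun t : n.-tuple letter => tnth t (Ordinal lt_pn)) xpredT) //=.
apply: eq_bigr => b _; rewrite -sum1_card; apply: eq_bigl => t.
set i := Ordinal lt_pn.
change ([&& reduced t, prefix p t & `[< A (eval t) >]] && (tnth t i == b) =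
  [&& reduced t, prefix (rcons p b) t & `[< A (eval t) >]]).
have -> : prefix (rcons p b) t = prefix p t && (tnth t i == b).
  rewrite !prefixE size_rcons (take_nth b) ?size_tuple // eqseq_rcons.
  by rewrite (tnth_nth b).
by case: (tnth t i == b); rewrite ?andbT ?andbF /= ?andbF.
Qed.

(** To count the words of length [n], cut them at length [m]: [D] bounds the number
of ways to complete a beginning that satisfies [B], and no other beginning can be
completed. *)
Lemma nwords_compose n m A B D p : (size p <= m <= n)%N ->
  (forall q, reduced q -> size q = m -> prefix p q ->
     (nwords n A q <= D * `[< B (eval q) >])%N) ->
  (nwords n A p <= D * nwords m B p)%N.
Proof.
move=> /andP[le_pm le_mn] ABq.
have [l em] : exists l, m = (size p + l)%N by exists (m - size p)%N; rewrite subnKC.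
elim: l p {le_pm} em ABq => [|l IH] p em ABq.
  have [red_p|nred_p] := boolP (reduced p).
    by rewrite (nwords_size B) ?em ?addn0 // red_p ABq ?prefix_refl ?em ?addn0.
  rewrite nwords_eq0 // => w _ red_w /prefixP[s ew]; case/negP: nred_p.
  by rewrite ew in red_w; apply: reduced_catl red_w.
have lt_pm : (size p < m)%N by rewrite em -addSnnS leq_addr.
rewrite !nwords_rcons // ?(leq_trans lt_pm) // big_distrr /=; apply: leq_sum => b _.
apply: IH; first by rewrite size_rcons addSnnS.
move=> q red_q eq_q /(prefix_trans (prefix_rcons p b)); exact: ABq.
Qed.

Lemma nwords_le n A p : (size p <= n)%N ->
  (nwords n A p <= #|{: letter}| ^ (n - size p))%N.
Proof.
move: {2}(n - size p)%N (erefl (n - size p)%N) => l.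
elim: l p => [|l IH] p el le_pn.
  rewrite el expn0 nwords_size ?leq_b1 //.
  by apply/eqP; rewrite eqn_leq le_pn -subn_eq0 el.
have lt_pn : (size p < n)%N by rewrite -subn_gt0 el.
rewrite nwords_rcons // el expnS -sum_nat_const; apply: leq_sum => b _.
have el' : (n - size (rcons p b))%N = l by rewrite size_rcons subnS el.
by rewrite -el' IH // size_rcons.
Qed.

Lemma nwordsT n p : p != [::] -> reduced p -> (size p <= n)%N ->
  nwords n setT p = (#|{: letter}|.-1 ^ (n - size p))%N.
Proof.
move: {2}(n - size p)%N (erefl (n - size p)%N) => l.
elim: l p => [|l IH] p el p0 red_p le_pn.
  rewrite el expn0 nwords_size ?red_p ?asboolT //.
  by apply/eqP; rewrite eqn_leq le_pn -subn_eq0 el.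
have lt_pn : (size p < n)%N by rewrite -subn_gt0 el.
case/lastP: p p0 red_p el le_pn lt_pn => // p a _ red_pa el le_pn lt_pn.
rewrite nwords_rcons // (bigD1 (letter_inv a)) //= nwords_eq0; last first.
  move=> w _ red_w /prefixP[s ew]; rewrite ew in red_w.
  have := reduced_catl red_w; rewrite -cats1 cat_rcons reduced_cat_cons.
  by rewrite /reduced /= eqxx andbF.
rewrite add0n el expnS -[X in (X * _)%N](cardC1 (letter_inv a)) -sum_nat_const.
apply: eq_big => // b nb.
have el' : (n - size (rcons (rcons p a) b))%N = l by rewrite size_rcons subnS el.
rewrite -el'; apply: IH => //; [by rewrite -size_eq0 size_rcons| |]; last first.
  by rewrite size_rcons.
rewrite -cats1 cat_rcons reduced_cat_cons red_pa.
by rewrite /reduced /= nb.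
Qed.

Lemma card_sphere A k :
  #|` fset_set (A `&` sphere k)| = nwords k A [::].
Proof.
have finA : finite_set (A `&` @sphere X k) by apply/finite_setIr/finite_sphere.
rewrite /nwords cardE -(size_map (@word X) (enum_fset _)) -(size_map val (enum _)).
apply/perm_size/uniq_perm.
- by rewrite map_inj_uniq ?fset_uniq //; apply: val_inj.
- by rewrite map_inj_uniq ?enum_uniq //; apply: val_inj.
move=> w; apply/mapP/mapP => [[x]|[t]].
  rewrite in_fset_set // => /set_mem[Ax /= /eqP sx] ->.
  exists (Tuple sx) => //; rewrite mem_enum inE /= prefix0s word_reduced evalK.
  exact/asboolP.
rewrite mem_enum inE prefix0s /= => /andP[red_t /asboolP At] ->.
exists (eval t); rewrite ?word_eval // in_fset_set //.
by apply/mem_set; split=> //; rewrite /sphere /mkset word_eval ?size_tuple.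
Qed.

Lemma nwords_inv k A :
  nwords k A [::] = nwords k [set x | A x^-1] [::].
Proof.
suff le_inv B : (nwords k B [::] <= nwords k [set x | B (x^-1)%g] [::])%N.
  apply/eqP; rewrite eqn_leq le_inv /=; apply: leq_trans (le_inv _) _.
  apply: nwords_le_sub => w _ _ _ /=.
  by rewrite invgK prefix0s.
pose f (t : k.-tuple letter) := rev_tuple (map_tuple (@letter_inv X) t).
have ef t : val (f t) = word_inv t by [].
have injf : injective f.
  by move=> t s eq_ts; apply/val_inj/(can_inj (@word_invK X)); rewrite -!ef eq_ts.
rewrite /nwords -(card_imset _ injf).
apply/subset_leq_card/fintype.subsetP => s /imsetP[t].
rewrite !inE !prefix0s /= => /andP[red_t /asboolP Bt] ->; rewrite ef.
rewrite word_inv_reduced //=; apply/asboolP.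
by rewrite /= -eval_inv word_invK.
Qed.

End Counting.

(** * Exponential decay *)

Section Decay.
Variable R : archiRealFieldType.
Implicit Types (x q b c rho : R).
Import Order.TTheory GRing.Theory Num.Theory.
Local Open Scope ring_scope.

Lemma bernoulli_ineq x n : -1 <= x -> 1 + x *+ n <= (1 + x) ^+ n.
Proof.
move=> x_ge; elim: n => [|n IH]; first by rewrite mulr0n addr0 expr0.
have x1 : 0 <= 1 + x by rewrite -lerBlDl sub0r.
rewrite exprS; apply: le_trans (ler_wpM2l x1 IH).
rewrite mulrDr mulr1 mulrDl mul1r mulrS addrA lerD2l lerDl.
by rewrite mulrnAr mulrn_wge0 // -expr2 sqr_ge0.
Qed.

Lemma expr_eventually_le q b c : 0 < q < 1 -> 0 < c ->
  exists n0, forall n, (n0 <= n)%N -> b * q ^+ n <= c.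
Proof.
move=> /andP[q0 q1] c0; have [b0|b0] := leP b 0.
  exists 0%N => n _; apply: le_trans (ltW c0).
  by rewrite pmulr_lle0 // exprn_gt0.
pose d := q^-1 - 1; have d0 : 0 < d by rewrite subr_gt0 invf_gt1.
exists (Num.bound (b / c / d)) => n le_n.
have bn : b / c / d <= n%:R.
  have b_ge : 0 <= b / c / d by rewrite !divr_ge0 // ltW.
  by apply: le_trans (ltW (archi_boundP b_ge)) _; rewrite ler_nat.
have ed : 1 + d = q^-1 by rewrite /d addrCA subrr addr0.
have : b / c <= q^-1 ^+ n.
  rewrite -ed; apply: le_trans (bernoulli_ineq _ _).
    move: bn; rewrite ler_pdivrMr // -[d *+ n]mulr_natl => /le_trans -> //.
    by rewrite lerDr.
  by apply: le_trans (ltW d0); rewrite lerN10.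
by rewrite exprVn ler_pdivrMr // mulrC -ler_pdivlMr ?exprn_gt0 // invrK.
Qed.

(** By hypothesis [f] is bounded along each residue class modulo [L.+1] by a multiple
of the powers of [rho]. The number [q] is chosen so that [q ^ (2 * L.+1)] is at least
[rho], by Bernoulli's inequality; one half of the factors [q] serves as the
required bound [q ^ k], and the other half absorbs the multiplicative constants for
[k] large. *)
Lemma geometric_decay (f : nat -> R) L k0 rho :
  (forall k, 0 <= f k) -> 0 <= rho < 1 ->
  (forall k, (k0 <= k)%N -> f (k + L.+1)%N <= rho * f k) ->
  exists2 q, 0 < q < 1 & exists k1, forall k, (k1 <= k)%N -> f k <= q ^+ k.
Proof.
move=> f0 /andP[rho0 rho1] f_rho.
pose x := (1 - rho) / (L.+1 + L.+1)%:R; pose q := 1 - x.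
have x0 : 0 < x by rewrite divr_gt0 // subr_gt0.
have x1 : x < 1.
  rewrite ltr_pdivrMr // mul1r (@le_lt_trans _ _ 1) //; first by rewrite lerBlDr lerDl.
  by rewrite ltr1n addSn addnS.
have q01 : 0 < q < 1 by rewrite subr_gt0 x1 gtrBl x0.
have [q0 q1] := andP q01.
have rho_q : rho <= q ^+ L.+1 * q ^+ L.+1.
  rewrite -exprD; apply: le_trans (bernoulli_ineq _ _); last by rewrite lerN2 ltW.
  by rewrite mulNrn -[x *+ _]mulr_natr mulfVK ?pnatr_eq0 // opprB addrC subrK.
pose b := \sum_(i < L.+1) f (k0 + i)%N.
have fb j i : (i < L.+1)%N ->
    f (k0 + i + j * L.+1)%N <= b * (q ^+ (j * L.+1) * q ^+ (j * L.+1)).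
  move=> lt_i; elim: j => [|j IH].
    rewrite mul0n addn0 !mulr1 /b (bigD1 (Ordinal lt_i)) //= lerDl.
    by apply: sumr_ge0.
  rewrite mulSn addnCA addnC; apply: le_trans (f_rho _ _) _.
    by rewrite -addnA leq_addr.
  apply: le_trans (ler_wpM2l rho0 IH) _; rewrite mulrCA.
  apply: ler_wpM2l; first exact: sumr_ge0.
  rewrite !exprD mulrACA; apply: ler_wpM2r => //.
  by rewrite mulr_ge0 // exprn_ge0 // ltW.
have [n0 bn] := expr_eventually_le b q01 (exprn_gt0 (k0 + L)%N q0).
exists q => //; exists (k0 + n0 + L.+1)%N => k le_k.
pose j := ((k - k0) %/ L.+1)%N; pose i := ((k - k0) %% L.+1)%N.
have lt_i : (i < L.+1)%N by rewrite ltn_mod.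
have ek : k = (k0 + i + j * L.+1)%N.
  rewrite -addnA (addnC i) -divn_eq subnKC //.
  by rewrite -addnA in le_k; apply: leq_trans (leq_addr _ _) le_k.
have le_n0 : (n0 <= j * L.+1)%N.
  move: le_k; rewrite {1}ek -!addnA leq_add2l => le_k.
  rewrite -(leq_add2l i); apply: leq_trans le_k; rewrite addnC leq_add2l.
  exact: ltnW.
rewrite {1}ek; apply: le_trans (fb _ _ lt_i) _.
rewrite mulrA ek exprD; apply: ler_wpM2r; first by rewrite exprn_ge0 // ltW.
by apply: le_trans (bn _ le_n0) _; rewrite ler_wiXn2l ?leq_add2l // ltW.
Qed.

End Decay.

(** * Growth of the core, of the transversal and of its unstable part *)

Section Growth.
Variables (X : finType) (C S : set (free_group X)).
Hypotheses (gC : subgroup C) (fgC : finitely_generated C).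
Hypotheses (infC : infinite_index C).
Local Notation letter := (X * bool)%type.
Local Notation core := (core C).
Local Notation d := (#|{: letter}|.-1).

(** Among the [d ^ L.+1] reduced extensions of a path in the core by [L.+1] letters, one
at least leaves the core. The empty path, which has one more extension by a
letter, is excluded by [0 < k]. *)
Lemma core_growth : exists L, forall k, (0 < k)%N ->
  (nwords (k + L.+1) core [::] <= (d ^ L.+1).-1 * nwords k core [::])%N.
Proof.
have [L LP] := core_uniform_escape gC fgC infC; exists L => k k0.
apply: nwords_compose => [|q red_q sq _]; first by rewrite /= leq_addr.
have q0 : q != [::] by rewrite -size_eq0 sq -lt0n.
have [/asboolP Kq|nKq] := boolP `[< core (eval q) >]; last first.
  rewrite nwords_eq0 // => w _ red_w pqw Kw; case/asboolP: nKq.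
  by apply: core_prefix Kw _ => //; rewrite !word_eval.
rewrite muln1 -ltnS; have [u [su red_qu nKqu]] := LP q red_q q0 Kq.
have sqL : (size q <= k + L.+1)%N by rewrite sq leq_addr.
have := nwordsT q0 red_q sqL; rewrite sq addKn => eT.
have squ : size (q ++ u) == (k + L.+1)%N by rewrite size_cat sq su.
have T0 : (0 < d ^ L.+1)%N.
  rewrite -eT; apply/card_gt0P; exists (Tuple squ).
  by rewrite inE /= red_qu prefix_prefix asboolT.
rewrite prednK // -eT; apply: proper_card; apply/fintype.properP; split.
  by apply/fintype.subsetP => t; rewrite !inE => /and3P[-> -> _]; rewrite asboolT.
exists (Tuple squ); rewrite !inE /= red_qu prefix_prefix /=; first by rewrite asboolT.
by apply/asboolPn.
Qed.

Hypothesis schS : schreier_transversal C S.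

(** Only the last [M] letters of the inverse of an unstable element are free. *)
Lemma unstable_growth : exists M, forall k, (M <= k)%N ->
  (nwords k (unstable_part C S) [::] <=
     #|{: letter}| ^ M * nwords (k - M) core [::])%N.
Proof.
have [M MP] := unstable_inv_core gC fgC schS; exists M => k le_Mk.
rewrite nwords_inv; apply: nwords_compose => [|q red_q sq _]; first by rewrite leq_subr.
have [/asboolP Kq|nKq] := boolP `[< core (eval q) >].
  have := @nwords_le _ k [set x | unstable_part C S x^-1] q.
  by rewrite sq leq_subr subKn // muln1; apply.
rewrite nwords_eq0 // => w sw red_w pqw /MP[y [Ky]].
rewrite invgK -[word _^-1]/(word_inv (word (eval w))) size_word_inv word_eval // sw.
move=> pyw le_ky; case/asboolP: nKq; apply: (core_prefix gC Ky).
rewrite word_eval //; move: pqw pyw; rewrite !prefixE => /eqP eq_q /eqP eq_y.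
by rewrite -[X in take _ X]eq_y take_takel ?eq_q // sq leq_subLR addnC.
Qed.

Lemma schreier_growth : exists s, forall k, (s <= k)%N ->
  (d ^ (k - s) <= nwords k S [::])%N.
Proof.
have [u [a [Su nKua red_ua]]] := schreier_escape gC fgC infC schS.
exists (size (rcons u a)) => k le_k.
rewrite -nwordsT //; last by rewrite -size_eq0 size_rcons.
apply: nwords_le_sub => w _ red_w /prefixP[v ew] _; rewrite prefix0s; split=> //.
rewrite ew cat_rcons in red_w *; exact: (schreier_extend gC schS).
Qed.

Lemma letters_gt1 : (1 < #|{: letter}|)%N.
Proof.
have [u [a _]] := schreier_escape gC fgC infC schS.
rewrite card_prod card_bool muln2 -addnn.
have X_gt0 : (0 < #|X|)%N by apply/card_gt0P; exists a.1.
exact: (leq_add X_gt0 X_gt0).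
Qed.

End Growth.

Section Negligible.
Import Order.TTheory GRing.Theory Num.Theory.
Local Open Scope ring_scope.
Variables (R : realType) (X : finType).
Implicit Types A B S C : set (free_group X).

Lemma relative_frequencyE A S k :
  relative_frequency R A S k = (nwords k A [::])%:R / (nwords k S [::])%:R.
Proof. by rewrite /relative_frequency !card_sphere. Qed.

Lemma exponentially_negligibleS A B S : A `<=` B ->
  exponentially_negligible R B S -> exponentially_negligible R A S.
Proof.
move=> AB [q q01 [k0 qP]]; exists q => //; exists k0 => k /qP; apply: le_trans.
rewrite !relative_frequencyE ler_wpM2r ?invr_ge0 // ler_nat.
by apply: nwords_le_sub => w _ _ _ /AB; rewrite prefix0s.
Qed.

Lemma unstable_negligible C S : subgroup C -> finitely_generated C ->
  infinite_index C -> schreier_transversal C S ->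
  exponentially_negligible R (unstable_part C S) S.
Proof.
move=> gC fgC infC schS.
have [L core_le] := core_growth gC fgC infC.
have [M uns_le] := unstable_growth gC fgC schS.
have [s S_ge] := schreier_growth gC fgC infC schS.
have := letters_gt1 gC fgC infC schS.
set n := #|_| in core_le uns_le S_ge *; set d := n.-1 in core_le S_ge * => n1.
have d0 : (0 < d)%N by rewrite -ltnS prednK // ltnW.
have dR e : 0 < (d ^ e)%:R :> R by rewrite ltr0n expn_gt0 d0.
(* f bounds the relative frequency of the unstable part and shrinks by the factor
   (d ^ L.+1).-1 / d ^ L.+1 when k grows by L.+1. *)
pose f k : R := (n ^ M * nwords (k - M) (core C) [::])%:R / (d ^ (k - s))%:R.
have [||k le_k|q q01 [k1 fq]] := @geometric_decay R f L (M + s).+1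
    ((d ^ L.+1).-1%:R / (d ^ L.+1)%:R).
- by move=> k; rewrite divr_ge0.
- by rewrite divr_ge0 //= ltr_pdivrMr // mul1r ltr_nat prednK ?expn_gt0 ?d0.
- have lt_Mk : (M < k)%N by apply: leq_trans le_k; rewrite ltnS leq_addr.
  have le_sk : (s <= k)%N by apply: leq_trans le_k; rewrite ltnW // ltnS leq_addl.
  rewrite /f -addnBAC 1?ltnW // -addnBAC // expnD [in leRHS]mulrACA -invfM.
  rewrite -!natrM [(d ^ L.+1 * _)%N]mulnC; apply: ler_wpM2r; first by rewrite invr_ge0.
  by rewrite ler_nat mulnCA leq_mul2l core_le ?subn_gt0 // orbT.
exists q => //; exists (maxn k1 (maxn M s)) => k.
rewrite !geq_max => /and3P[le_k1 le_M le_s].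
apply: le_trans (fq k le_k1); rewrite relative_frequencyE /f.
apply: ler_pM => //; rewrite ?invr_ge0 // ?ler_nat ?uns_le //.
rewrite lef_pV2 ?posrE ?dR // ?ler_nat ?S_ge //.
by rewrite ltr0n (leq_trans _ (S_ge _ _)) ?expn_gt0 ?d0.
Qed.

End Negligible.

Theorem corollary5p2 (R : realType) (X : finType) (C S : set (free_group X)) :
  subgroup C -> finitely_generated C -> infinite_index C ->
  schreier_transversal C S ->
  exponentially_negligible R (singular_part C S) S /\
  exponentially_negligible R (unstable_part C S) S.
Proof.
move=> gC fgC infC schS; have uns := unstable_negligible R gC fgC infC schS.
split=> //; apply: exponentially_negligibleS uns.
by apply: singular_sub_unstable => //; case: schS.
Qed.
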